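(* Let $0<q<1$ and $a>0$. The polynomials $d_n(\mu(m);a;q)$, $n=0,1,2,\dots$, are orthogonal on the set of points $\mu(m)=q^{-m}-a\,q^m$, $m=0,1,2,\dots$, and the orthogonality relation is $$\sum_{m=0}^\infty\frac{(1+aq^{2m})\,a^m}{(-aq^m;q)_\infty\,(q;q)_m}\,q^{m(3m-1)/2}\,d_n(\mu(m);a;q)\,d_{n'}(\mu(m);a;q)=\frac{(q;q)_n}{a^n q^{n(n+1)/2}}\,\delta_{nn'} ,\qquad n,n'=0,1,2,\dots .$$
   Context: Notation: $(x;q)_k=\prod_{j=0}^{k-1}(1-xq^j)$, $(x;q)_\infty=\prod_{j\ge0}(1-xq^j)$. Dual alternative $q$-Charlier polynomials: $d_n(\mu(m);a;q)={}_3\phi_0(q^{-m},-aq^m,q^{-n};\,-\,;\,q,-q^n/a)$, where ${}_3\phi_0(\alpha_1,\alpha_2,\alpha_3;-;q,z)=\sum_{k\ge0}\frac{(\alpha_1;q)_k(\alpha_2;q)_k(\alpha_3;q)_k}{(q;q)_k}\,q^{-k(k-1)}z^k$. This is a polynomial of degree $n$ in $\mu(m)=q^{-m}-aq^m$. *)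

(* Defs.v *)
From HB Require Import structures.
From mathcomp Require Import all_boot all_order all_algebra.
From mathcomp Require Import all_classical all_reals all_analysis.

Set Implicit Arguments.
Unset Strict Implicit.
Unset Printing Implicit Defensive.

Import Order.TTheory GRing.Theory Num.Theory.
Import numFieldNormedType.Exports.

Local Open Scope classical_set_scope.
Local Open Scope ring_scope.

Section QCharlier.
Variables (R : realType) (q : R).

(* (x; q)_k *)
Definition qpoch (x : R) (k : nat) : R := \prod_(j < k) (1 - x * q ^+ j).

(* (x; q)_oo; the partial products converge whenever `|q| < 1 *)
Definition qpoch_inf (x : R) : R := limn (qpoch x).

(* 3phi0(a1, a2, a3; -; q, z); the series is finite as soon as one of the ai
   is q^-n for some natural number n *)
Definition phi30 (a1 a2 a3 z : R) : R :=
  limn (series (fun k : nat =>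
    qpoch a1 k * qpoch a2 k * qpoch a3 k / qpoch q k
    * q ^- (k * k.-1) * z ^+ k)).

Definition mu (a : R) (m : nat) : R := q ^- m - a * q ^+ m.

(* d_n(mu(m); a; q), as a function of the index m of the lattice point mu(m) *)
Definition dual_alt_qCharlier (a : R) (n m : nat) : R :=
  phi30 (q ^- m) (- (a * q ^+ m)) (q ^- n) (- (q ^+ n / a)).

(* m(3m-1) is even, and the truncated predecessor is harmless at m = 0 *)
Definition qCharlier_weight (a : R) (m : nat) : R :=
  (1 + a * q ^+ (2 * m)) * a ^+ m / (qpoch_inf (- (a * q ^+ m)) * qpoch q m)
  * q ^+ (m * (3 * m).-1)./2.

End QCharlier.

(* Main.v *)
Require Import Defs.
From HB Require Import structures.
From mathcomp Require Import all_boot all_order all_algebra.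
From mathcomp Require Import all_classical all_reals all_analysis.
From mathcomp Require Import ring lra zify.

Set Implicit Arguments.
Unset Strict Implicit.
Unset Printing Implicit Defensive.

Import Order.TTheory GRing.Theory Num.Theory.
Import numFieldNormedType.Exports.

Local Open Scope classical_set_scope.
Local Open Scope ring_scope.

(** Write [w] for the weight, [d_n] for the polynomials and [L(f)] for the sum
    of [w(m) f(m)] over all [m]. Orthogonality follows from two facts about
    [d_n]: [L(d_n)] is 1 for [n = 0] and 0 otherwise
    ([wsum_dual_alt_qCharlier]), and the three-term recurrence
    [mu d_n = - a d_(n+1) + q^-n d_n - q^-n (1 - q^n) d_(n-1)]
    ([dual_alt_qCharlier_rec]). Expanding [L(mu d_n d_n')] by the recurrence for
    [d_n] and by the one for [d_n'] gives a relation that determines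
    [L(d_(n+1) d_n')] from the earlier rows; the row [n = 0] is the first
    fact, and the claimed right-hand side satisfies the same relation. The
    recurrence also shows, by induction, that [d_n] is a polynomial of degree
    [n] in [mu].

    The values [L(d_n)] come from those on the basis
    [phi_k(m) = (q^-m; q)_k (-a q^m; q)_k], in which [d_n] is defined. The
    function [phi_k] vanishes for [m < k], and shifting [m] by one turns
    [w phi_(k+1)] into [- a w phi_k] with [a] replaced by [a q^2], so that
    [L(phi_k) = (-a)^k q^(k(k-1)) L(1)], where [L(1)] is taken at the parameter
    [a q^(2k)] ([wsum_mu_basis]).

    It remains to see that [L(1) = 1] for every [a > 0]
    ([cvg_series_weight]). This is Sylvester's identity
    [sum_m (1 - x q^(2m)) (x; q)_m (-x)^m q^(m(3m-1)/2) / (q; q)_m = (x; q)_oo]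
    at [x = - a]. Splitting
    [1 + a q^(2m) = (1 - q^m) + q^m (1 + a q^m)] shows that the partial sums for
    [a] and [a q] differ by a term that tends to 0, while for small [a] all the
    nonempty partial sums are close to 1. *)

Section DualAlternativeQCharlier.
Variables (R : realType) (q : R).
Hypotheses (q_gt0 : 0 < q) (q_lt1 : q < 1).
Implicit Types (a b x y : R) (n m k N : nat).

Let q_neq0 : q != 0. Proof. by rewrite gt_eqF. Qed.
Let qX_gt0 n : 0 < q ^+ n. Proof. exact: exprn_gt0. Qed.
Let qX_neq0 n : q ^+ n != 0. Proof. by rewrite gt_eqF. Qed.
Let qX_le1 n : q ^+ n <= 1. Proof. by rewrite exprn_ile1 // ltW. Qed.
Let oneBq_gt0 : 0 < 1 - q. Proof. by rewrite subr_gt0. Qed.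

(** * q-shifted factorials *)

Lemma qpoch0 x : qpoch q x 0 = 1.
Proof. by rewrite /qpoch big_ord0. Qed.

Lemma qpochSr x k : qpoch q x k.+1 = qpoch q x k * (1 - x * q ^+ k).
Proof. by rewrite /qpoch big_ord_recr. Qed.

Lemma qpochSl x k : qpoch q x k.+1 = (1 - x) * qpoch q (x * q) k.
Proof.
rewrite /qpoch big_ord_recl expr0 mulr1; congr (_ * _).
by apply: eq_bigr => i _; rewrite lift0 exprS mulrA.
Qed.

Lemma oneBqX_gt0 k : 0 < 1 - q ^+ k.+1.
Proof. by rewrite subr_gt0 exprn_ilt1 // ltW. Qed.

Lemma qpochqS k : qpoch q q k.+1 = qpoch q q k * (1 - q ^+ k.+1).
Proof. by rewrite qpochSr exprS. Qed.

Lemma qpochq_ge k : (1 - q) ^+ k <= qpoch q q k.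
Proof.
elim: k => [|k IH]; first by rewrite qpoch0 expr0.
rewrite qpochqS exprSr ler_pM //; first by rewrite exprn_ge0 // ltW.
  exact: ltW.
by rewrite lerB // exprS ler_piMr // ltW.
Qed.

Lemma qpochq_gt0 k : 0 < qpoch q q k.
Proof. by apply: lt_le_trans (qpochq_ge k); rewrite exprn_gt0. Qed.

(** For [k > n] the product contains the factor [1 - q^-n q^n]. *)
Lemma qpoch_qVX_eq0 n k : (n < k)%N -> qpoch q (q ^- n) k = 0.
Proof.
move=> ltnk; rewrite /qpoch (bigD1 (Ordinal ltnk)) //=.
by rewrite mulVf // subrr mul0r.
Qed.

Lemma qpochN_ge1 x k : 0 <= x -> 1 <= qpoch q (- x) k.
Proof.
move=> x0; elim: k => [|k IH]; first by rewrite qpoch0.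
rewrite qpochSr -[leLHS]mulr1 ler_pM // mulNr opprK lerDl.
by rewrite mulr_ge0 // ltW.
Qed.

Lemma nondecreasing_qpochN x : 0 <= x -> nondecreasing_seq (qpoch q (- x)).
Proof.
move=> x0; apply/nondecreasing_seqP => k.
rewrite qpochSr ler_peMr //; first exact: le_trans ler01 (qpochN_ge1 _ x0).
by rewrite mulNr opprK lerDl mulr_ge0 // ltW.
Qed.

Lemma qpochN_le x k : 0 <= x -> qpoch q (- x) k <= expR (x / (1 - q)).
Proof.
move=> x0.
have [s_ge0 ->] : 0 <= q ^+ k / (1 - q) /\
    x / (1 - q) = x * ((1 - q ^+ k) / (1 - q)) + x * (q ^+ k / (1 - q)).
  split; first by rewrite divr_ge0 // ltW.
  by field; rewrite gt_eqF.
(* 1 + x q^j <= exp (x q^j), and the q^j with j < k sum to (1 - q^k)/(1 - q) *)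
apply: (@le_trans _ _ (expR (x * ((1 - q ^+ k) / (1 - q))))); last first.
  by rewrite ler_expR lerDl mulr_ge0.
elim: k {s_ge0} => [|k IH].
  by rewrite qpoch0 expr0 subrr mul0r mulr0 expR0.
have -> : x * ((1 - q ^+ k.+1) / (1 - q)) =
    x * ((1 - q ^+ k) / (1 - q)) + x * q ^+ k.
  by rewrite exprS; field; rewrite gt_eqF.
rewrite qpochSr expRD ler_pM //.
- exact: le_trans ler01 (qpochN_ge1 _ x0).
- by rewrite mulNr opprK addr_ge0 // mulr_ge0 // ltW.
- by rewrite mulNr opprK expR_ge1Dx.
Qed.

Lemma is_cvg_qpochN x : 0 <= x -> cvgn (qpoch q (- x)).
Proof.
move=> x0; apply: nondecreasing_is_cvgn; first exact: nondecreasing_qpochN.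
by exists (expR (x / (1 - q))) => _ [k _ <-]; exact: qpochN_le.
Qed.

Lemma qpoch_infN_ge x k : 0 <= x -> qpoch q (- x) k <= qpoch_inf q (- x).
Proof.
move=> x0; apply: nondecreasing_cvgn_le; first exact: nondecreasing_qpochN.
exact: is_cvg_qpochN.
Qed.

Lemma qpoch_infN_le x : 0 <= x -> qpoch_inf q (- x) <= expR (x / (1 - q)).
Proof.
move=> x0; apply: limr_le; first exact: is_cvg_qpochN.
by apply: nearW => k; exact: qpochN_le.
Qed.

Lemma qpoch_infN_ge1 x : 0 <= x -> 1 <= qpoch_inf q (- x).
Proof. by move=> x0; rewrite -(qpoch0 (- x)); exact: qpoch_infN_ge. Qed.

Lemma qpoch_infN_gt0 x : 0 <= x -> 0 < qpoch_inf q (- x).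
Proof. by move=> x0; exact: lt_le_trans ltr01 (qpoch_infN_ge1 x0). Qed.

Lemma qpoch_infNS x : 0 <= x ->
  qpoch_inf q (- x) = (1 + x) * qpoch_inf q (- (x * q)).
Proof.
move=> x0; apply: cvg_lim => //.
rewrite -(cvg_shiftS (qpoch q (- x))) /=.
have -> : (fun k => qpoch q (- x) k.+1) =
    (fun k => (1 + x) * qpoch q (- (x * q)) k).
  by apply/funext => k; rewrite qpochSl opprK mulNr.
apply: cvgM; first exact: cvg_cst.
by apply: is_cvg_qpochN; rewrite mulr_ge0 // ltW.
Qed.

(** * Sylvester's identity: the total mass of the weight is one *)

(** The pentagonal number [m(3m-1)/2], exponent of [q] in the weight. *)
Let pent m := (m * (3 * m).-1)./2.

Lemma pentS m : pent m.+1 = (pent m + (3 * m).+1)%N.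
Proof.
have E : (m.+1 * (3 * m.+1).-1 = m * (3 * m).-1 + ((3 * m).+1).*2)%N.
  by case: m => // m; nia.
by rewrite /pent E halfD odd_double doubleK andbF.
Qed.

Lemma pent_ge m : (m * m <= pent m)%N.
Proof. by elim: m => // m IH; rewrite pentS; nia. Qed.

Lemma qX_pentS m : q ^+ pent m.+1 = q ^+ pent m * (q ^+ m) ^+ 3 * q.
Proof. by rewrite pentS exprD exprSr -exprM [(m * 3)%N]mulnC mulrA. Qed.

Lemma weightE a m : qCharlier_weight q a m =
  (1 + a * q ^+ (2 * m)) * a ^+ m / (qpoch_inf q (- (a * q ^+ m)) * qpoch q q m)
  * q ^+ pent m.
Proof. by []. Qed.

Let aqX_ge0 a m : 0 < a -> 0 <= a * q ^+ m.
Proof. by move=> a0; rewrite mulr_ge0 // ltW. Qed.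

(** The part [1 - q^m] of the splitting
    [1 + a q^(2m) = (1 - q^m) + q^m (1 + a q^m)] of the weight. *)
Definition weight_tail a m : R :=
  (1 - q ^+ m) * a ^+ m / (qpoch_inf q (- (a * q ^+ m)) * qpoch q q m)
  * q ^+ pent m.

(** The complementary part [q^m (1 + a q^m)] of the weight of parameter [a] at
    [m] and the part [1 - q^(m+1)] at [m + 1] add up to the weight of parameter
    [a q] at [m]. *)
Lemma weight_shift a m : 0 < a ->
  qCharlier_weight q a m + weight_tail a m.+1 =
  qCharlier_weight q (a * q) m + weight_tail a m.
Proof.
move=> a0.
have E : qpoch_inf q (- (a * q ^+ m)) =
    (1 + a * q ^+ m) * qpoch_inf q (- (a * q ^+ m.+1)).
  by rewrite qpoch_infNS ?aqX_ge0 // exprSr mulrA.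
have h1 : qpoch_inf q (- (a * q ^+ m.+1)) != 0.
  by rewrite gt_eqF // qpoch_infN_gt0 // aqX_ge0.
have h2 : 1 + a * q ^+ m != 0 by rewrite gt_eqF // ltr_wpDr // aqX_ge0.
have h3 : qpoch q q m != 0 by rewrite gt_eqF // qpochq_gt0.
have h4 : 1 - q ^+ m.+1 != 0 by rewrite gt_eqF // oneBqX_gt0.
rewrite !weightE /weight_tail E qX_pentS qpochqS.
have -> : a * q * q ^+ m = a * q ^+ m.+1 by rewrite exprS mulrA.
have -> : q ^+ (2 * m) = (q ^+ m) ^+ 2 by rewrite mulnC exprM.
move: (qpoch_inf _ _) (qpoch _ _ _) h1 h2 h3 h4 => P Q.
rewrite exprMn [a ^+ m.+1]exprS [q ^+ m.+1]exprS.
move: (q ^+ m) (q ^+ pent m) (a ^+ m).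
by move=> z e A h1 h2 h3 h4; field; rewrite h1 h2 h3 h4.
Qed.

(** The telescoped form of Sylvester's functional equation
    [F(a) = (1 + a) F(a q)]; the factor [1 + a] is absorbed by the infinite
    product in the weight. *)
Lemma series_weight_shift a N : 0 < a ->
  series (qCharlier_weight q a) N =
  series (qCharlier_weight q (a * q)) N - weight_tail a N.
Proof.
move=> a0; rewrite /series /=; elim: N => [|N IH].
  by rewrite !big_geq // /weight_tail expr0 subrr !mul0r subrr.
rewrite !big_nat_recr //= IH.
have := weight_shift N a0.
by move: (qCharlier_weight _ _ _) (qCharlier_weight _ _ _) => u v; lra.
Qed.

Lemma weight_tail_bound a m : 0 < a ->
  0 <= weight_tail a m <= (a / (1 - q) * q ^+ m) ^+ m.
Proof.
move=> a0.
have P0 : 0 <= (1 - q ^+ m) * a ^+ m.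
  by rewrite mulr_ge0 ?subr_ge0 // exprn_ge0 // ltW.
have D1 : (1 - q) ^+ m <= qpoch_inf q (- (a * q ^+ m)) * qpoch q q m.
  rewrite -[leLHS]mul1r ler_pM // ?qpoch_infN_ge1 ?aqX_ge0 ?qpochq_ge //.
  by rewrite exprn_ge0 // ltW.
have X0 : 0 < (1 - q) ^+ m by rewrite exprn_gt0.
have D0 := lt_le_trans X0 D1.
apply/andP; split.
  by rewrite /weight_tail mulr_ge0 // ?(ltW (qX_gt0 _)) // divr_ge0 // ltW.
(* the exponent of q in the weight is at least m^2 *)
rewrite /weight_tail !exprMn exprVn -exprM.
apply: ler_pM.
- by rewrite divr_ge0 // ltW.
- exact: ltW.
- apply: ler_pM => //.
  + by rewrite invr_ge0 ltW.
  + by rewrite ler_piMl ?exprn_ge0 ?(ltW a0) // gerBl ltW.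
  + by rewrite lef_pV2.
- by rewrite ler_wiXn2l ?pent_ge // ltW.
Qed.

Lemma cvg_qX_scale (c : R) : (fun m => c * q ^+ m) @ \oo --> (0 : R).
Proof.
rewrite -[X in _ --> X](mulr0 c); apply: cvgM; first exact: cvg_cst.
by apply: cvg_expr; rewrite ger0_norm // ltW.
Qed.

Lemma near_qX_scale_lt (c e : R) : 0 < e ->
  \forall m \near \oo, c * q ^+ m < e.
Proof. by move=> e0; exact: (cvgr_lt _ (cvg_qX_scale c)). Qed.

Lemma cvg_weight_tail a : 0 < a -> weight_tail a @ \oo --> (0 : R).
Proof.
move=> a0.
have c0 : 0 <= a / (1 - q) by rewrite divr_ge0 // ltW.
have half0 : (fun m => (2^-1 : R) ^+ m) @ \oo --> (0 : R).
  by apply: cvg_expr; rewrite ger0_norm ?invr_ge0 // invf_lt1 // ltr1n.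
apply: (squeeze_cvgr _ (cvg_cst 0) half0).
have := near_qX_scale_lt (a / (1 - q)) (e := 2^-1).
rewrite invr_gt0 ltr0n => /(_ isT).
apply: filterS => m lt_half.
have /andP[-> /= le_tail] := weight_tail_bound m a0.
apply: le_trans le_tail _.
apply: lerXn2r; last exact: ltW.
  by rewrite nnegrE mulr_ge0 // ltW.
by rewrite nnegrE invr_ge0.
Qed.

Lemma cvg_series_weight_shift a n : 0 < a ->
  (fun N => series (qCharlier_weight q a) N -
            series (qCharlier_weight q (a * q ^+ n)) N) @ \oo --> (0 : R).
Proof.
elim: n a => [|n IH] a a0.
  rewrite expr0 mulr1; under eq_fun do rewrite subrr.
  exact: cvg_cst.
have -> : (fun N => series (qCharlier_weight q a) N -
      series (qCharlier_weight q (a * q ^+ n.+1)) N) =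
    (fun N => (series (qCharlier_weight q (a * q)) N -
      series (qCharlier_weight q (a * q * q ^+ n)) N) - weight_tail a N).
  apply/funext => N; rewrite (series_weight_shift N a0) exprS mulrA.
  by rewrite addrAC.
rewrite -[X in _ --> X]subr0; apply: cvgB; last exact: cvg_weight_tail.
by apply: IH; rewrite mulr_gt0.
Qed.

(** Both bounds are uniform in the number of terms and tend to 1 with [b]. *)
Lemma series_weight_small b N : 0 < b -> b / (1 - q) <= 2^-1 ->
  1 - b / (1 - q) <= series (qCharlier_weight q b) N.+1 <= 1 + 4 * (b / (1 - q)).
Proof.
move=> b0; set r := b / (1 - q) => r_le.
have r0 : 0 <= r by rewrite divr_ge0 // ltW.
have b_le_r : b <= r by rewrite ler_pdivlMr // ler_piMr ?(ltW b0) // gerBl ltW.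
have w0 : qCharlier_weight q b 0 = (1 + b) / qpoch_inf q (- b).
  by rewrite weightE muln0 expr0 !mulr1 qpoch0 mulr1.
have Pgt0 : 0 < qpoch_inf q (- b) by rewrite qpoch_infN_gt0 // ltW.
have w0_le : qCharlier_weight q b 0 <= 1.
  rewrite w0 ler_pdivrMr // mul1r.
  apply: le_trans (qpoch_infN_ge 1 (ltW b0)).
  by rewrite qpochSr qpoch0 mul1r expr0 mulr1 opprK.
have w0_ge : 1 - r <= qCharlier_weight q b 0.
  (* (-b; q)_oo <= exp r and 1 - r <= exp (-r) *)
  rewrite w0; apply: (@le_trans _ _ (expR (- r))); first exact: expR_ge1Dx.
  rewrite expRN; apply: (@le_trans _ _ (qpoch_inf q (- b))^-1).
    by rewrite lef_pV2 ?posrE ?expR_gt0 // qpoch_infN_le // ltW.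
  by rewrite ler_peMl ?invr_ge0 ?(ltW Pgt0) // lerDl ltW.
have w_bound m : 0 <= qCharlier_weight q b m <= 2 * r ^+ m.
  have X0 : 0 < (1 - q) ^+ m by rewrite exprn_gt0.
  have D1 : (1 - q) ^+ m <= qpoch_inf q (- (b * q ^+ m)) * qpoch q q m.
    rewrite -[leLHS]mul1r ler_pM // ?qpoch_infN_ge1 ?aqX_ge0 ?qpochq_ge //.
    exact: ltW.
  have D0 := lt_le_trans X0 D1.
  have num0 : 0 <= (1 + b * q ^+ (2 * m)) * b ^+ m.
    by rewrite mulr_ge0 ?addr_ge0 ?aqX_ge0 // exprn_ge0 // ltW.
  rewrite weightE mulr_ge0 /= ?divr_ge0 // ?(ltW D0) ?(ltW (qX_gt0 _)) //.
  rewrite -[leRHS]mulr1 ler_pM // ?divr_ge0 // ?(ltW D0) ?(ltW (qX_gt0 _)) //.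
  rewrite /r exprMn exprVn mulrA ler_pM // ?invr_ge0 ?(ltW D0) //; last first.
    by rewrite lef_pV2.
  rewrite ler_wpM2r ?exprn_ge0 ?(ltW b0) //.
  have : b * q ^+ (2 * m) <= b by rewrite ler_piMr // ltW.
  by have : 2^-1 <= 1 :> R; [rewrite invf_le1 // ler1n|lra].
rewrite /series /=; apply/andP; split.
  rewrite big_nat_recl //=; apply: le_trans w0_ge _.
  by rewrite lerDl sumr_ge0 // => m _; have /andP[] := w_bound m.+1.
(* For r <= 1/2 the terms 2 r^m, m >= 1, sum to at most 4 r; the sharper bound
   below makes the induction on N go through. *)
apply: (@le_trans _ _ (1 + 4 * r - 4 * r ^+ N.+1)); last first.
  by rewrite gerBl mulr_ge0 // exprn_ge0.
elim: N => [|N IH]; first by rewrite big_nat1 expr1 addrK.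
rewrite big_nat_recr //=; have /andP[_] := w_bound N.+1.
have : r ^+ N.+2 <= 2^-1 * r ^+ N.+1 by rewrite exprS ler_wpM2r // exprn_ge0.
by move: IH; lra.
Qed.

(** Sylvester's identity. Replacing [a] by [a q^n] does not change the limit of
    the partial sums, and brings [a] into the range where they are close to 1. *)
Lemma cvg_series_weight a : 0 < a ->
  series (qCharlier_weight q a) @ \oo --> (1 : R).
Proof.
move=> a0; apply/cvgrPdist_lt => e e0.
have [n [n_half n_e]] : exists n,
    a / (1 - q) * q ^+ n < 2^-1 /\ a / (1 - q) * q ^+ n < e / 8.
  have c1 := near_qX_scale_lt (a / (1 - q)) (e := 2^-1).
  have c2 := near_qX_scale_lt (a / (1 - q)) (e := e / 8).
  rewrite invr_gt0 ltr0n in c1; rewrite divr_gt0 // in c2.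
  have [n _ Hn] := filterI (c1 isT) (c2 isT).
  by exists n; have [] := Hn n (leqnn n).
have bE : a * q ^+ n / (1 - q) = a / (1 - q) * q ^+ n by rewrite mulrAC.
have b0 : 0 < a * q ^+ n by rewrite mulr_gt0.
have /cvgrPdist_lt/(_ (e / 2)) := cvg_series_weight_shift n a0.
rewrite divr_gt0 // => /(_ isT) close.
have N1 : \forall N \near \oo, (0 < N)%N by exists 1%N.
apply: filterS2 N1 close => -[//|N] _.
have := series_weight_small N b0; rewrite bE => /(_ (ltW n_half)) /andP[].
move: (series _ _) (series _ _) => S T lo hi.
rewrite sub0r normrN ltr_norml => /andP[h1 h2].
have r0 : 0 < a / (1 - q) * q ^+ n by rewrite mulr_gt0 // divr_gt0.
by rewrite ltr_norml; apply/andP; split; lra.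
Qed.

(** * Summation against the weight *)

(** [wsum a f l]: the function [f] of the lattice index is summable against
    the weight, with sum [l]. *)
Definition wsum a (f : nat -> R) (l : R) : Prop :=
  series (fun m => qCharlier_weight q a m * f m) @ \oo --> l.

Lemma wsumD a f g l l' : wsum a f l -> wsum a g l' ->
  wsum a (fun m => f m + g m) (l + l').
Proof.
move=> cf cg; rewrite /wsum.
have -> : series (fun m => qCharlier_weight q a m * (f m + g m)) =
    (fun N => series (fun m => qCharlier_weight q a m * f m) N +
              series (fun m => qCharlier_weight q a m * g m) N).
  apply/funext => N; rewrite /series /= -big_split /=.
  by apply: eq_bigr => m _; rewrite mulrDr.
exact: cvgD.
Qed.

Lemma wsumZ a (c : R) f l : wsum a f l -> wsum a (fun m => c * f m) (c * l).
Proof.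
move=> cf; rewrite /wsum.
have -> : series (fun m => qCharlier_weight q a m * (c * f m)) =
    (fun N => c * series (fun m => qCharlier_weight q a m * f m) N).
  apply/funext => N; rewrite /series /= mulr_sumr.
  by apply: eq_bigr => m _; rewrite mulrCA.
by apply: cvgM => //; exact: cvg_cst.
Qed.

Lemma wsum0 a : wsum a (fun=> 0) 0.
Proof.
rewrite /wsum; have -> : series (fun m => qCharlier_weight q a m * 0) = cst 0.
  by apply/funext => N; rewrite /series /= big1 // => m _; rewrite mulr0.
exact: cvg_cst.
Qed.

Lemma wsum_sum a K (f : nat -> nat -> R) (l : nat -> R) :
  (forall k, wsum a (f k) (l k)) ->
  wsum a (fun m => \sum_(k < K) f k m) (\sum_(k < K) l k).
Proof.
move=> cf; elim: K => [|K IH].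
  rewrite big_ord0; under eq_fun do rewrite big_ord0.
  exact: wsum0.
rewrite big_ord_recr /=; under eq_fun do rewrite big_ord_recr /=.
exact: wsumD.
Qed.

(** The numerator factors [(q^-m; q)_k (-a q^m; q)_k] of the series defining
    the polynomials; as functions of [m] they are polynomials of degree [k] in
    [mu q a m]. *)
Definition mu_basis a k m : R :=
  qpoch q (q ^- m) k * qpoch q (- (a * q ^+ m)) k.

Lemma mu_basis0 a m : mu_basis a 0 m = 1.
Proof. by rewrite /mu_basis !qpoch0 mulr1. Qed.

Lemma mu_basisS a k m : mu_basis a k.+1 m =
  mu_basis a k m * (1 - a * q ^+ (2 * k) - q ^+ k * mu q a m).
Proof.
rewrite /mu_basis !qpochSr /mu mulnC exprM.
have := qX_neq0 m.
move: (qpoch _ _ _) (qpoch _ _ _) => P Q.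
by move: (q ^+ m) (q ^+ k) => z y z0; field.
Qed.

(** The shift [m -> m + 1] turns the basis element of index [k + 1] and the
    weight of parameter [a] into those of index [k] and parameter [a q^2]. *)
Lemma weight_mu_basis_shift a k m : 0 < a ->
  qCharlier_weight q a m.+1 * mu_basis a k.+1 m.+1 =
  - a * (qCharlier_weight q (a * q ^+ 2) m * mu_basis (a * q ^+ 2) k m).
Proof.
move=> a0.
have E : qpoch_inf q (- (a * q ^+ m.+1)) =
    (1 + a * q ^+ m.+1) * qpoch_inf q (- (a * q ^+ m.+2)).
  by rewrite qpoch_infNS ?aqX_ge0 // -mulrA -exprSr.
have h1 : qpoch_inf q (- (a * q ^+ m.+2)) != 0.
  by rewrite gt_eqF // qpoch_infN_gt0 // aqX_ge0.
have h2 : 1 + a * q ^+ m.+1 != 0 by rewrite gt_eqF // ltr_wpDr // aqX_ge0.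
have h3 : qpoch q q m != 0 by rewrite gt_eqF // qpochq_gt0.
have h4 : 1 - q ^+ m.+1 != 0 by rewrite gt_eqF // oneBqX_gt0.
have -> : mu_basis a k.+1 m.+1 =
    (1 - q ^- m.+1) * (1 + a * q ^+ m.+1) * mu_basis (a * q ^+ 2) k m.
  have e1 : q ^- m.+1 * q = q ^- m.
    by rewrite exprS invfM mulrAC mulVf // mul1r.
  have e2 : - (a * q ^+ m.+1) * q = - (a * q ^+ 2 * q ^+ m).
    by rewrite !exprS expr0; ring.
  by rewrite /mu_basis !qpochSl e1 e2 opprK mulrACA.
rewrite !weightE E qX_pentS qpochqS.
have -> : a * q ^+ 2 * q ^+ m = a * q ^+ m.+2 by rewrite !exprS expr0; ring.
have -> : (a * q ^+ 2) ^+ m = a ^+ m * (q ^+ m) ^+ 2 by rewrite exprMn exprAC.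
have -> : q ^+ (2 * m.+1) = (q ^+ m.+1) ^+ 2 by rewrite mulnC exprM.
have -> : q ^+ (2 * m) = (q ^+ m) ^+ 2 by rewrite mulnC exprM.
move: (qpoch_inf _ _) (qpoch _ _ _) (mu_basis _ _ _) h1 h2 h3 h4 => P Q B.
have := qX_neq0 m; rewrite [a ^+ m.+1]exprS [q ^+ m.+1]exprS.
move: (q ^+ m) (q ^+ pent m) (a ^+ m).
by move=> z e A z0 h1 h2 h3 h4; field; rewrite q_neq0 z0 h1 h2 h3 h4.
Qed.

Lemma wsum_mu_basis a k : 0 < a ->
  wsum a (mu_basis a k) ((- a) ^+ k * q ^+ (k * k.-1)).
Proof.
elim: k a => [|k IH] a a0.
  rewrite !expr0 mulr1 /wsum.
  under eq_fun do rewrite mu_basis0 mulr1.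
  exact: cvg_series_weight.
rewrite /wsum -(cvg_shiftS (series _)) /=.
have -> : (fun N => series
      (fun m => qCharlier_weight q a m * mu_basis a k.+1 m) N.+1) =
    (fun N => - a * series (fun m => qCharlier_weight q (a * q ^+ 2) m *
                                     mu_basis (a * q ^+ 2) k m) N).
  apply/funext => N; rewrite /series /= big_nat_recl //=.
  (* the term m = 0 vanishes since (1; q)_(k+1) = 0 *)
  rewrite {1}/mu_basis qpoch_qVX_eq0 // mul0r mulr0 add0r mulr_sumr.
  by apply: eq_bigr => m _; exact: weight_mu_basis_shift.
have -> : (- a) ^+ k.+1 * q ^+ (k.+1 * k) =
    - a * ((- (a * q ^+ 2)) ^+ k * q ^+ (k * k.-1)).
  rewrite exprS -mulrA -mulNr exprMn -!mulrA -exprM -exprD.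
  by congr (_ * (_ * q ^+ _)); case: k {IH} => // k; nia.
apply: cvgM; first exact: cvg_cst.
by apply: IH; rewrite mulr_gt0.
Qed.

(** * The polynomials *)

(** The product [(1 - y)(q - y)...(q^(k-1) - y)]; at [y = q^n] it equals
    [(-1)^k q^(nk) (q^-n; q)_k]. *)
Definition ypoch y k : R := \prod_(j < k) (q ^+ j - y).

(** At [y = q^n], the coefficient of [mu_basis a k] in [d_n]. Leaving [y] free
    turns the shifts of [n] into the substitutions [y -> q y] and [y -> y / q]. *)
Definition dcoef a y k : R :=
  ypoch y k / (qpoch q q k * a ^+ k * q ^+ (k * k.-1)).

Lemma ypochS y k : ypoch y k.+1 = ypoch y k * (q ^+ k - y).
Proof. by rewrite /ypoch big_ord_recr. Qed.

Lemma ypoch_qX_eq0 n k : (n < k)%N -> ypoch (q ^+ n) k = 0.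
Proof.
by move=> ltnk; rewrite /ypoch (bigD1 (Ordinal ltnk)) //= subrr mul0r.
Qed.

Lemma dcoef_qX_eq0 a n k : (n < k)%N -> dcoef a (q ^+ n) k = 0.
Proof. by move=> ltnk; rewrite /dcoef ypoch_qX_eq0 // mul0r. Qed.

Lemma ypoch_qpoch n k :
  ypoch (q ^+ n) k = (-1) ^+ k * (q ^+ n) ^+ k * qpoch q (q ^- n) k.
Proof.
elim: k => [|k IH]; first by rewrite /ypoch big_ord0 qpoch0 !expr0 !mulr1.
rewrite ypochS IH qpochSr !exprS; have := qX_neq0 n.
by move: (q ^+ n) (q ^+ k) (qpoch _ _ _) => y z P y0; field.
Qed.

Lemma dual_alt_qCharlierE a n m K : 0 < a -> (n < K)%N ->
  dual_alt_qCharlier q a n m =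
  \sum_(k < K) dcoef a (q ^+ n) k * mu_basis a k m.
Proof.
move=> a0 ltnK; rewrite /dual_alt_qCharlier /phi30.
set u := (fun k : nat => _).
have uE k : u k = dcoef a (q ^+ n) k * mu_basis a k m.
  rewrite /u /dcoef /mu_basis ypoch_qpoch [in LHS]exprNn expr_div_n.
  have h1 : qpoch q q k != 0 by rewrite gt_eqF // qpochq_gt0.
  have h2 : a ^+ k != 0 by rewrite expf_neq0 // gt_eqF.
  move: h1 h2 (qX_neq0 (k * k.-1)); move: ((q ^+ n) ^+ k) ((-1) ^+ k) => e f.
  by move=> h1 h2 h3; field; rewrite h1 h2 h3.
apply: cvg_lim => //; apply: cvg_near_cst; exists K => // N /= leKN.
rewrite /series /= (big_cat_nat (leq0n K) leKN) //= [X in _ + X]big_nat_cond [X in _ + X]big1.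
  by rewrite addr0 big_mkord; apply: eq_bigr => k _; exact: uE.
move=> k /andP[/andP[leKk _] _].
by rewrite uE dcoef_qX_eq0 ?mul0r // (leq_trans ltnK).
Qed.

Lemma dcoef0 a y : dcoef a y 0 = 1.
Proof. by rewrite /dcoef /ypoch big_ord0 qpoch0 !expr0 !mulr1 divr1. Qed.

Lemma dual_alt_qCharlier0 a m : 0 < a -> dual_alt_qCharlier q a 0 m = 1.
Proof.
move=> a0; rewrite (@dual_alt_qCharlierE a 0 m 1) // big_ord1 dcoef0.
by rewrite mu_basis0 mulr1.
Qed.

Lemma ypoch_qM y k : ypoch (q * y) k.+1 = q ^+ k * (1 - q * y) * ypoch y k.
Proof.
elim: k => [|k IH]; first by rewrite ypochS /ypoch !big_ord0 expr0 !mul1r mulr1.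
by rewrite ypochS IH ypochS exprS; ring.
Qed.

Lemma ypoch_divq y k : (1 - y) * ypoch (y / q) k = ypoch y k.+1 / q ^+ k.
Proof.
elim: k => [|k IH].
  by rewrite ypochS /ypoch !big_ord0 expr0 mul1r mulr1 divr1.
rewrite [in LHS]ypochS mulrA IH [in RHS]ypochS exprS.
have := qX_neq0 k; move: (ypoch y k.+1) (q ^+ k) => P z z0.
by field; rewrite q_neq0 z0.
Qed.

Lemma dcoef_denS a k :
  qpoch q q k.+1 * a ^+ k.+1 * q ^+ (k.+1 * k) =
  qpoch q q k * a ^+ k * q ^+ (k * k.-1) *
  ((1 - q * q ^+ k) * a * (q ^+ k) ^+ 2).
Proof.
have -> : (k.+1 * k = k * k.-1 + k * 2)%N by case: k => // k; nia.
by rewrite qpochqS exprD [q ^+ (k * 2)]exprM [a ^+ _]exprS [q ^+ k.+1]exprS; ring.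
Qed.

(** The truncated three-term recurrence. It holds for any nonzero [y], with a
    defect proportional to the last coefficient kept; at [y = q^n] this
    coefficient vanishes for [K > n]. *)
Lemma dcoef_rec a y m K : 0 < a -> y != 0 ->
  let S z := \sum_(k < K.+1) dcoef a z k * mu_basis a k m in
  mu q a m * S y + a * S (q * y) - y^-1 * S y + y^-1 * ((1 - y) * S (y / q)) =
  - (dcoef a y K / q ^+ K * mu_basis a K.+1 m).
Proof.
move=> a0 y0 /=; elim: K => [|K IH].
  rewrite !big_ord1 !dcoef0 mu_basisS mu_basis0 muln0 expr0.
  by field.
rewrite !(big_ord_recr K.+1) /= [mu_basis a K.+2 m]mu_basisS.
have -> : q ^+ (2 * K.+1) = (q ^+ K.+1) ^+ 2 by rewrite mulnC exprM.
move: (\sum_(_ < _) _) (\sum_(_ < _) _) (\sum_(_ < _) _) IH => S3 S2 S1.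
have cq : dcoef a (y / q) K.+1 * (1 - y) =
    ypoch y K.+1 * (q ^+ K.+1 - y) / q ^+ K.+1 /
    (qpoch q q K.+1 * a ^+ K.+1 * q ^+ (K.+1 * K)).
  by rewrite /dcoef mulrAC -[_ * (1 - y)]mulrC ypoch_divq [in LHS]ypochS.
have -> : y^-1 * ((1 - y) * (S3 + dcoef a (y / q) K.+1 * mu_basis a K.+1 m)) =
    y^-1 * ((1 - y) * S3) + y^-1 * (dcoef a (y / q) K.+1 * (1 - y)) *
      mu_basis a K.+1 m.
  by ring.
rewrite {}cq /dcoef ypoch_qM dcoef_denS ypochS [q ^+ K.+1]exprS.
have h1 : 1 - q * q ^+ K != 0 by rewrite -exprS gt_eqF // oneBqX_gt0.
have h2 : qpoch q q K * a ^+ K * q ^+ (K * K.-1) != 0.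
  by rewrite !mulf_neq0 // ?gt_eqF ?qpochq_gt0 ?exprn_gt0.
have h3 : a != 0 by rewrite gt_eqF.
have := qX_neq0 K.
move: (_ * q ^+ (K * _)) (q ^+ K) (ypoch y K) (mu_basis _ _ _) h1 h2 => D z T B.
move=> h1 h2 h4 IH.
have -> : mu q a m * (S1 + T * (z - y) / (D * ((1 - q * z) * a * z ^+ 2)) * B) =
  mu q a m * S1 + mu q a m * (T * (z - y) / (D * ((1 - q * z) * a * z ^+ 2)) * B).
  by rewrite mulrDr.
have {}IH : mu q a m * S1 = - (T / D / z * B) - a * S2 + y^-1 * S1 -
    y^-1 * ((1 - y) * S3) by rewrite -IH; ring.
rewrite {}IH; field.
by rewrite h1 h2 h3 h4 y0 q_neq0.
Qed.

(** At [n = 0] the coefficient of [d_(n-1)] vanishes, so that the truncated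
    predecessor is harmless. *)
Lemma dual_alt_qCharlier_rec a n m : 0 < a ->
  mu q a m * dual_alt_qCharlier q a n m =
  - a * dual_alt_qCharlier q a n.+1 m
  + q ^- n * dual_alt_qCharlier q a n m
  - q ^- n * (1 - q ^+ n) * dual_alt_qCharlier q a n.-1 m.
Proof.
move=> a0; have := dcoef_rec m n.+1 a0 (qX_neq0 n).
rewrite /= [dcoef a (q ^+ n) n.+1]dcoef_qX_eq0 // !mul0r oppr0 -exprS.
rewrite -!dual_alt_qCharlierE //.
have -> : (1 - q ^+ n) *
      (\sum_(k < n.+2) dcoef a (q ^+ n / q) k * mu_basis a k m) =
    (1 - q ^+ n) * dual_alt_qCharlier q a n.-1 m.
  case: n => [|n]; first by rewrite expr0 subrr !mul0r.
  rewrite /= [in X in _ * X = _]exprSr mulfK // -dual_alt_qCharlierE //.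
  by rewrite ltnS leqW.
by move=> e; apply/eqP; rewrite -subr_eq0 -e; apply/eqP; ring.
Qed.

(** * Orthogonality *)

(** The [q]-binomial sum behind the vanishing of the mean of [d_n]: for
    [y = q^n] and [K = n > 0], the product on the right contains [q^n - y = 0]. *)
Lemma sum_ypoch y K :
  \sum_(k < K.+1) (-1) ^+ k * ypoch y k / qpoch q q k =
  (-1) ^+ K * (\prod_(j < K) (q ^+ j.+1 - y)) / qpoch q q K.
Proof.
elim: K => [|K IH].
  by rewrite big_ord1 /ypoch !big_ord0.
have shift : ypoch y K.+1 = (1 - y) * \prod_(j < K) (q ^+ j.+1 - y).
  by rewrite /ypoch big_ord_recl.
rewrite big_ord_recr IH big_ord_recr /= shift qpochqS exprS.
have h1 : 1 - q ^+ K.+1 != 0 by rewrite gt_eqF // oneBqX_gt0.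
have h2 : qpoch q q K != 0 by rewrite gt_eqF // qpochq_gt0.
move: (\prod_(_ < _) _) (qpoch _ _ _) (q ^+ K.+1) h1 h2 ((-1) ^+ K).
by move=> P Q z h1 h2 f; field; rewrite h1 h2.
Qed.

Lemma wsum_dual_alt_qCharlier a n : 0 < a ->
  wsum a (dual_alt_qCharlier q a n) (n == 0%N)%:R.
Proof.
move=> a0.
have -> : (n == 0%N)%:R =
    \sum_(k < n.+1) dcoef a (q ^+ n) k * ((- a) ^+ k * q ^+ (k * k.-1)).
  transitivity (\sum_(k < n.+1) (-1) ^+ k * ypoch (q ^+ n) k / qpoch q q k).
    rewrite sum_ypoch; case: n => [|n].
      by rewrite big_ord0 qpoch0 !expr0 !mulr1 divr1.
    by rewrite big_ord_recr /= subrr mulr0 mulr0 mul0r.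
  apply: eq_bigr => k _; rewrite /dcoef [(- a) ^+ k]exprNn.
  have h1 : qpoch q q k != 0 by rewrite gt_eqF // qpochq_gt0.
  have h2 : a ^+ k != 0 by rewrite expf_neq0 // gt_eqF.
  have h3 := qX_neq0 (k * k.-1).
  by move: (a ^+ k) (q ^+ (k * _)) ((-1) ^+ k) h2 h3 => A z e h2 h3; field;
    rewrite h1 h2 h3.
have -> : dual_alt_qCharlier q a n =
    (fun m => \sum_(k < n.+1) dcoef a (q ^+ n) k * mu_basis a k m).
  by apply/funext => m; exact: dual_alt_qCharlierE.
apply: (@wsum_sum a n.+1 (fun k m => dcoef a (q ^+ n) k * mu_basis a k m)
  (fun k => dcoef a (q ^+ n) k * ((- a) ^+ k * q ^+ (k * k.-1)))) => k.
by apply: wsumZ; exact: wsum_mu_basis.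
Qed.

(** The squared norm of [d_n]. *)
Definition dnorm a n : R := qpoch q q n / (a ^+ n * q ^+ (n * n.+1)./2).

Lemma dnormS a n : 0 < a ->
  dnorm a n.+1 = dnorm a n * (1 - q ^+ n.+1) / (a * q ^+ n.+1).
Proof.
move=> a0; rewrite /dnorm qpochqS.
have -> : ((n.+1 * n.+2)./2 = (n * n.+1)./2 + n.+1)%N.
  have -> : (n.+1 * n.+2 = n * n.+1 + (n.+1).*2)%N by nia.
  by rewrite halfD odd_double doubleK andbF.
rewrite exprD [a ^+ _]exprS !invfM.
by move: (q ^+ n.+1) (q ^+ _) (a ^+ n) => z e A; ring.
Qed.

(** The two ways of applying the recurrence to [mu d_n d_n'] determine the sums
    in row [n + 1] from those in rows [n] and [n - 1]. *)
Lemma wsum_orthogonal_step a n : 0 < a ->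
  (forall n', wsum a (fun m => dual_alt_qCharlier q a n.-1 m *
     dual_alt_qCharlier q a n' m) (dnorm a n.-1 * (n.-1 == n')%:R)) ->
  (forall n', wsum a (fun m => dual_alt_qCharlier q a n m *
     dual_alt_qCharlier q a n' m) (dnorm a n * (n == n')%:R)) ->
  forall n', wsum a (fun m => dual_alt_qCharlier q a n.+1 m *
     dual_alt_qCharlier q a n' m) (dnorm a n.+1 * (n.+1 == n')%:R).
Proof.
move=> a0 IH1 IH2 n'; have an0 : a != 0 by rewrite gt_eqF.
have -> : (fun m => dual_alt_qCharlier q a n.+1 m *
                    dual_alt_qCharlier q a n' m) =
  (fun m => ((q ^- n - q ^- n') / a *
      (dual_alt_qCharlier q a n m * dual_alt_qCharlier q a n' m)
    + - (q ^- n * (1 - q ^+ n)) / a *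
      (dual_alt_qCharlier q a n.-1 m * dual_alt_qCharlier q a n' m))
    + (1 * (dual_alt_qCharlier q a n m * dual_alt_qCharlier q a n'.+1 m)
    + q ^- n' * (1 - q ^+ n') / a *
      (dual_alt_qCharlier q a n m * dual_alt_qCharlier q a n'.-1 m))).
  apply/funext => m.
  have := dual_alt_qCharlier_rec n m a0; have := dual_alt_qCharlier_rec n' m a0.
  move: (q ^- n) (q ^- n') => u v; move: (q ^+ n) (q ^+ n') => z w.
  move: (dual_alt_qCharlier q a n.+1 m) (dual_alt_qCharlier q a n'.+1 m) => F G.
  move: (dual_alt_qCharlier q a n m) (dual_alt_qCharlier q a n' m) => f g.
  move: (dual_alt_qCharlier q a n.-1 m) (dual_alt_qCharlier q a n'.-1 m) => f' g'.
  move: (mu q a m) => x rec' rec.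
  have -> : F = (u * f - u * (1 - z) * f' - x * f) / a by rewrite rec; field.
  have -> : G = (v * g - v * (1 - w) * g' - x * g) / a by rewrite rec'; field.
  by field.
set l := (X in wsum _ _ X).
suff -> : l = ((q ^- n - q ^- n') / a * (dnorm a n * (n == n')%:R)
    + - (q ^- n * (1 - q ^+ n)) / a * (dnorm a n.-1 * (n.-1 == n')%:R))
    + (1 * (dnorm a n * (n == n'.+1)%:R)
    + q ^- n' * (1 - q ^+ n') / a * (dnorm a n * (n == n'.-1)%:R)).
  by do 2?[apply: wsumD]; apply: wsumZ.
rewrite {}/l.
have d1 : (q ^- n - q ^- n') / a * (dnorm a n * (n == n')%:R) = 0.
  by case: eqVneq => [->|_]; rewrite ?subrr ?mul0r ?mulr0.
have d2 : q ^- n * (1 - q ^+ n) / a * (dnorm a n.-1 * (n.-1 == n')%:R) =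
    dnorm a n * (n == n'.+1)%:R.
  case: n {IH1 IH2 d1} => [|n]; first by rewrite expr0 subrr !mulr0 !mul0r.
  rewrite /= eqSS dnormS // invfM.
  by move: (_ == _)%:R (q ^+ n.+1) (_^-1) (_^-1) => e z i j; ring.
have d3 : q ^- n' * (1 - q ^+ n') / a * (dnorm a n * (n == n'.-1)%:R) =
    dnorm a n.+1 * (n.+1 == n')%:R.
  case: n' {d1 d2} => [|n']; first by rewrite expr0 subrr !mulr0 !mul0r.
  rewrite /= eqSS; case: eqVneq => [<-|_]; last by rewrite !mulr0.
  by rewrite dnormS // invfM !mulr1; ring.
by rewrite d1 !mulNr d2 d3 mul1r add0r addrA addNr add0r.
Qed.

Lemma wsum_orthogonal a n n' : 0 < a ->
  wsum a (fun m => dual_alt_qCharlier q a n m * dual_alt_qCharlier q a n' m)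
    (dnorm a n * (n == n')%:R).
Proof.
move=> a0.
pose P n := forall n', wsum a (fun m => dual_alt_qCharlier q a n m *
  dual_alt_qCharlier q a n' m) (dnorm a n * (n == n')%:R).
have P0 : P 0%N.
  move=> k; rewrite /dnorm qpoch0 !expr0 mulr1 divr1 mul1r eq_sym.
  under eq_fun do rewrite dual_alt_qCharlier0 // mul1r.
  exact: wsum_dual_alt_qCharlier.
suff [_ Pn] : P n.-1 /\ P n by exact: Pn.
elim: n => [|n [IH1 IH2]]; first by split.
by split=> //; exact: wsum_orthogonal_step.
Qed.

(** * Polynomiality *)

Lemma dual_alt_qCharlier_poly a n : 0 < a -> exists p : {poly R},
  size p = n.+1 /\ forall m, dual_alt_qCharlier q a n m = p.[mu q a m].
Proof.
move=> a0; have an0 : a != 0 by rewrite gt_eqF.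
pose P n := exists p : {poly R},
  size p = n.+1 /\ forall m, dual_alt_qCharlier q a n m = p.[mu q a m].
have P0 : P 0%N.
  exists 1; split=> [|m]; first exact: size_poly1.
  by rewrite hornerC dual_alt_qCharlier0.
suff [_ Pn] : P n.-1 /\ P n by exact: Pn.
elim: n => [|n [[p' [sp' p'E]] [p [sp pE]]]]; first by split.
split; first by exists p.
exists (- a^-1 *: (p * 'X - ((q ^- n) *: p - (q ^- n * (1 - q ^+ n)) *: p'))).
split=> [|m].
  rewrite size_scale ?oppr_eq0 ?invr_eq0 // size_polyDl.
    by rewrite size_mulX -?size_poly_eq0 sp.
  rewrite size_polyN size_mulX -?size_poly_eq0 sp // ltnS.
  apply: leq_trans (size_polyD _ _) _; rewrite size_polyN geq_max.
  rewrite !(leq_trans (size_scale_leq _ _)) ?sp ?sp' //.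
  by case: (n).
rewrite !hornerE -pE -p'E [_ * mu q a m]mulrC dual_alt_qCharlier_rec //.
by move: (q ^- n) => u; field.
Qed.

End DualAlternativeQCharlier.

Theorem theorem7p1 (R : realType) (q a : R)
    (q_gt0 : 0 < q) (q_lt1 : q < 1) (a_gt0 : 0 < a) :
  (forall n : nat, exists p : {poly R},
      size p = n.+1 /\
      forall m : nat, dual_alt_qCharlier q a n m = p.[mu q a m]) /\
  (forall n n' : nat,
      series (fun m : nat => qCharlier_weight q a m
                * dual_alt_qCharlier q a n m * dual_alt_qCharlier q a n' m)
        @ \oo -->
      qpoch q q n / (a ^+ n * q ^+ (n * n.+1)./2) * (n == n')%:R).
Proof.
split=> [n|n n']; first exact: dual_alt_qCharlier_poly.
have := @wsum_orthogonal _ _ q_gt0 q_lt1 _ n n' a_gt0.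
by rewrite /wsum; under eq_fun do rewrite mulrA.
Qed.
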